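(* Let $R$ be a ring. Then $$\mathrm{l\text{-}gl\text{-}dim}(R)=\max\{\mathrm{id}_R(M): M\in\mathcal F_1\mathcal F(R)\}=\max\{\mathrm{id}_R(M): M\in\mathcal F_1^{\mathrm{fp}}\mathcal F(R)\}.$$
   Context: $R$ is an associative ring with unit and modules are unital. $\mathrm{l\text{-}gl\text{-}dim}(R)$ is the left global dimension of $R$ and $\mathrm{id}_R$ denotes injective dimension. Here $\max$ is understood as the supremum, with value $+\infty$ allowed. $\mathcal F_1$ is the class of right $R$-modules of flat dimension at most $1$; $\mathcal F_1^{\mathrm{fp}}$ is its subclass of finitely presented modules. A left $R$-module $M$ is $\mathcal F_1$-flat (resp. $\mathcal F_1^{\mathrm{fp}}$-flat) if $\mathrm{Tor}_1^R(H,M)=0$ for every $H\in\mathcal F_1$ (resp. $H\in\mathcal F_1^{\mathrm{fp}}$); the class of all such left modules is denoted $\mathcal F_1\mathcal F(R)$ (resp. $\mathcal F_1^{\mathrm{fp}}\mathcal F(R)$). *)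

(* Defs.v *)
From HB Require Import structures.
From mathcomp Require Import all_boot all_order all_algebra.
From mathcomp Require Import boolp classical_sets constructive_ereal ereal.
From mathcomp Require Import reals Rstruct.
From mathcomp Require Import freeg.
Set Implicit Arguments.
Unset Strict Implicit.
Unset Printing Implicit Defensive.
Import Order.TTheory GRing.Theory Num.Theory.
Local Open Scope classical_set_scope.
Local Open Scope ring_scope.
Local Open Scope quotient_scope.

(* Left R-modules are lmodType R and right R-modules are lmodType R^c, where
   R^c is the opposite ring: for H : lmodType R^c, a *: h is the product h a. *)

Section Tensor.
Variables (R : pzRingType) (H : lmodType R^c) (M : lmodType R).

(* The subgroup of the free abelian group on H * M generated by the
   relations of the tensor product over R. *)
Inductive tensor_span : {freeg (H * M)} -> Prop :=
| tensor_span0 : tensor_span 0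
| tensor_spanB x y : tensor_span x -> tensor_span y -> tensor_span (x - y)
| tensor_spanDl (h h' : H) (m : M) :
    tensor_span (<< (h + h', m) >> - << (h, m) >> - << (h', m) >>)
| tensor_spanDr (h : H) (m m' : M) :
    tensor_span (<< (h, m + m') >> - << (h, m) >> - << (h, m') >>)
| tensor_spanZ (a : R) (h : H) (m : M) :
    tensor_span (<< ((a : R^c) *: h, m) >> - << (h, a *: m) >>).

Definition tensor_rel : {pred {freeg (H * M)}} := fun x => `[< tensor_span x >].

Lemma tensor_rel_zmod_closed : zmod_closed tensor_rel.
Proof.
split=> [|x y]; first exact/asboolP/tensor_span0.
by move=> /asboolP xS /asboolP yS; exact/asboolP/tensor_spanB.
Qed.

HB.instance Definition _ :=
  GRing.isZmodClosed.Build {freeg (H * M)} tensor_rel tensor_rel_zmod_closed.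

Definition tensor : zmodType := Quotient.quot tensor_rel.

Definition tensor_pi (x : {freeg (H * M)}) : tensor :=
  \pi_(Quotient.quot tensor_rel) x.

Definition tens (h : H) (m : M) : tensor := tensor_pi << (h, m) >>.

Lemma tensor_pi_zmod_morphism : zmod_morphism tensor_pi.
Proof. by move=> x y; rewrite /tensor_pi raddfB. Qed.

HB.instance Definition _ := GRing.isZmodMorphism.Build
  {freeg (H * M)} tensor tensor_pi tensor_pi_zmod_morphism.

Lemma tensor_piP x y : tensor_pi x = tensor_pi y <-> tensor_span (x - y).
Proof.
by split=> [/eqP|xyS]; [|apply/eqP];
  rewrite -Quotient.idealrBE; [move/asboolP|exact/asboolP].
Qed.

End Tensor.

Section TensorMap.
Variables (R : pzRingType) (H H' : lmodType R^c) (M M' : lmodType R).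
Variables (f : {linear H -> H'}) (g : {linear M -> M'}).

Definition freeg_map : {freeg (H * M)} -> {freeg (H' * M')} :=
  fglift (fun k => << (f k.1, g k.2) >>).

(* The map f (x) g; it does not depend on the representative, by tensor_mapE. *)
Definition tensor_map (t : tensor H M) : tensor H' M' :=
  tensor_pi (freeg_map (repr (t : Quotient.quot (@tensor_rel R H M)))).

Lemma freeg_mapB : {morph freeg_map : x y / x - y}.
Proof. exact: lift_is_additive. Qed.

Lemma freeg_mapU (h : H) (m : M) : freeg_map << (h, m) >> = << (f h, g m) >>.
Proof. by rewrite /freeg_map liftU scale1r. Qed.

Lemma freeg_map_span x : tensor_span x -> tensor_span (freeg_map x).
Proof.
elim=> [|{}x y _ IHx _ IHy|h h' m|h m m'|a h m];
  rewrite ?(freeg_mapB, freeg_mapU) ?(raddfD f, raddfD g) ?linearZ.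
- by rewrite -(subrr 0) freeg_mapB subrr; exact: tensor_span0.
- exact: tensor_spanB.
- exact: tensor_spanDl.
- exact: tensor_spanDr.
- exact: tensor_spanZ.
Qed.

Lemma tensor_mapE x : tensor_map (tensor_pi x) = tensor_pi (freeg_map x).
Proof.
apply/tensor_piP; rewrite -freeg_mapB; apply: freeg_map_span.
by apply/tensor_piP; rewrite /tensor_pi reprK.
Qed.

Lemma tensor_map_tens h m : tensor_map (tens h m) = tens (f h) (g m).
Proof. by rewrite tensor_mapE freeg_mapU. Qed.

Lemma tensor_map_zmod_morphism : zmod_morphism tensor_map.
Proof.
move=> t u; rewrite -(reprK (t : Quotient.quot _)) -(reprK (u : Quotient.quot _)).
by rewrite -/(tensor_pi _) -raddfB !tensor_mapE freeg_mapB raddfB.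
Qed.

HB.instance Definition _ := GRing.isZmodMorphism.Build
  (tensor H M) (tensor H' M') tensor_map tensor_map_zmod_morphism.

End TensorMap.

Definition is_surjective (A B : Type) (f : A -> B) := forall y, exists x, f x = y.

Definition exact_at (A B C : zmodType) (f : A -> B) (g : B -> C) :=
  forall y, g y = 0 <-> exists x, f x = y.

Definition is_projective (S : pzRingType) (P : lmodType S) :=
  forall (A B : lmodType S) (p : {linear A -> B}) (f : {linear P -> B}),
    is_surjective p -> exists h : {linear P -> A}, forall x, p (h x) = f x.

Definition is_injective (S : pzRingType) (E : lmodType S) :=
  forall (A B : lmodType S) (i : {linear A -> B}) (f : {linear A -> E}),
    injective i -> exists h : {linear B -> E}, forall x, h (i x) = f x.

Definition is_flat (R : pzRingType) (H : lmodType R^c) :=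
  forall (A B : lmodType R) (i : {linear A -> B}),
    injective i -> injective (tensor_map (idfun : {linear H -> H}) i).

Definition finitely_presented (S : pzRingType) (H : lmodType S) :=
  exists m n (g : {linear 'rV[S]_m -> 'rV[S]_n}) (p : {linear 'rV[S]_n -> H}),
    is_surjective p /\ exact_at g p.

Record left_resolution (S : pzRingType) (H : lmodType S) := LeftResolution {
  lres_obj :> nat -> lmodType S;
  lres_d : forall n, {linear lres_obj n.+1 -> lres_obj n};
  lres_aug : {linear lres_obj 0 -> H};
  lres_aug_surj : is_surjective lres_aug;
  lres_exact0 : exact_at (lres_d 0) lres_aug;
  lres_exactS : forall n, exact_at (lres_d n.+1) (lres_d n) }.

Record right_resolution (S : pzRingType) (M : lmodType S) := RightResolution {
  rres_obj :> nat -> lmodType S;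
  rres_d : forall n, {linear rres_obj n -> rres_obj n.+1};
  rres_aug : {linear M -> rres_obj 0};
  rres_aug_inj : injective rres_aug;
  rres_exact0 : exact_at rres_aug (rres_d 0);
  rres_exactS : forall n, exact_at (rres_d n) (rres_d n.+1) }.

Definition length_le (S : pzRingType) (P : nat -> lmodType S) (n : nat) :=
  forall k, (n < k)%N -> forall x : P k, x = 0.

(* Homological dimensions take their values in {0, 1, 2, ..., +oo}, embedded
   in the extended reals; the zero module has dimension 0. *)
Notation exreal := (\bar Rdefinitions.R).

Definition least_length (L : set nat) : exreal :=
  ereal_inf [set n%:R%:E | n in L].

Definition proj_dim (S : pzRingType) (M : lmodType S) : exreal :=
  least_length [set n | exists P : left_resolution M,
    (forall k, is_projective (P k)) /\ length_le P n].

Definition flat_dim (R : pzRingType) (H : lmodType R^c) : exreal :=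
  least_length [set n | exists F : left_resolution H,
    (forall k, is_flat (F k)) /\ length_le F n].

Definition inj_dim (S : pzRingType) (M : lmodType S) : exreal :=
  least_length [set n | exists E : right_resolution M,
    (forall k, is_injective (E k)) /\ length_le E n].

(* The supremum of dim over the class C; a lmodType S is too large to be the
   carrier of a set, so the supremum is taken over the set of values. *)
Definition dim_sup (S : pzRingType) (C : lmodType S -> Prop)
    (dim : lmodType S -> exreal) : exreal :=
  ereal_sup [set d | exists2 M, C M & d = dim M].

Definition l_gl_dim (R : pzRingType) : exreal :=
  dim_sup (fun _ : lmodType R => True) (@proj_dim R).

(* Tor_1^R(H, M) = 0: for a projective resolution P of H, the complex P (x) M
   has no homology in degree 1. Projective resolutions exist, and the condition
   does not depend on the one chosen. *)
Definition Tor1_eq0 (R : pzRingType) (H : lmodType R^c) (M : lmodType R) :=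
  forall P : left_resolution H, (forall k, is_projective (P k)) ->
    exact_at (tensor_map (lres_d P 1) (idfun : {linear M -> M}))
             (tensor_map (lres_d P 0) (idfun : {linear M -> M})).

Definition F1 (R : pzRingType) (H : lmodType R^c) : Prop :=
  (flat_dim H <= 1%:E)%E.

Definition F1fp (R : pzRingType) (H : lmodType R^c) : Prop :=
  F1 H /\ finitely_presented H.

Definition F1_flat (R : pzRingType) (M : lmodType R) : Prop :=
  forall H : lmodType R^c, F1 H -> Tor1_eq0 H M.

Definition F1fp_flat (R : pzRingType) (M : lmodType R) : Prop :=
  forall H : lmodType R^c, F1fp H -> Tor1_eq0 H M.

(* Main.v *)
Require Import Defs.
From HB Require Import structures.
From mathcomp Require Import all_boot all_order all_algebra.
From mathcomp Require Import boolp classical_sets functions constructive_ereal ereal.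
From mathcomp Require Import reals Rstruct.
From mathcomp Require Import freeg.
Set Implicit Arguments.
Unset Strict Implicit.
Unset Printing Implicit Defensive.
Import Order.TTheory GRing.Theory Num.Theory.
Local Open Scope ring_scope.
Local Open Scope quotient_scope.

(* Let n be finite. For M any left module, take a projective resolution P of M
   with syzygies K_0 = M, K_1, ... . If H is a right module of flat dimension at
   most 1, then Tor_2(H, -) = 0, so Tor_1(H, -) vanishes on submodules of free
   modules; hence K_{n+1}, a submodule of P_n, is F_1-flat. If all F_1-flat modules
   have injective dimension at most n, then
   Ext^1(K_n, K_{n+1}) = Ext^{n+1}(M, K_{n+1}) = 0, the sequence
   0 -> K_{n+1} -> P_n -> K_n -> 0 splits, and pd M <= n. Dually, if all modules
   have projective dimension at most n, the n-th cosyzygy of an injective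
   resolution of any N splits off an injective module, so id N <= n. As F_1-flat
   modules are F_1^fp-flat, the three suprema are squeezed together. *)

(** * Kernels, cokernels and factorizations *)

Definition is_subgroup (V : zmodType) (T : V -> Prop) :=
  T 0 /\ forall x y, T x -> T y -> T (x - y).

Section Subgroup.
Variables (V : zmodType) (T : V -> Prop).
Hypothesis Tsub : is_subgroup T.

Lemma subgroupN x : T x -> T (- x).
Proof. by case: Tsub => T0 TB Tx; rewrite -[- x]add0r; apply: TB. Qed.

Lemma subgroupD x y : T x -> T y -> T (x + y).
Proof.
by case: Tsub => T0 TB Tx Ty; rewrite -[y]opprK; apply: (TB) => //; apply: subgroupN.
Qed.

Lemma subgroupMz x (n : int) : T x -> T (x *~ n).
Proof.
move=> Tx; have Tn m : T (x *+ m).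
  by elim: m => [|m IH]; [case: Tsub | rewrite mulrS; apply: subgroupD].
by case: n => n; [exact: Tn | rewrite NegzE mulrNz; apply: subgroupN; exact: Tn].
Qed.
End Subgroup.

Record short_exact (S : pzRingType) (A B C : lmodType S)
    (i : {linear A -> B}) (p : {linear B -> C}) : Prop := ShortExact {
  se_inj : injective i;
  se_exact : exact_at i p;
  se_surj : is_surjective p }.

Section LinearConstructions.
Variable S : pzRingType.
Implicit Types A B C : lmodType S.

Lemma linear_bundle A B (f : A -> B) :
  linear f -> exists g : {linear A -> B}, g =1 f.
Proof.
move=> fl; pose g : {linear A -> B} := HB.pack f (GRing.isLinear.Build S A B _ f fl).
by exists g.
Qed.

Lemma linear_factor_surj A B C (p : {linear A -> B}) (u : {linear A -> C}) :
  is_surjective p -> (forall x, p x = 0 -> u x = 0) ->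
  exists v : {linear B -> C}, forall x, v (p x) = u x.
Proof.
move=> /choice[s sK] kpu.
have vE x : u (s (p x)) = u x.
  by apply/eqP; rewrite -subr_eq0 -raddfB /= kpu// raddfB /= sK subrr.
have [|v vP] := @linear_bundle _ _ (u \o s).
  by move=> a x y /=; rewrite -{1}[x]sK -{1}[y]sK -linearP vE linearP.
by exists v => x; rewrite vP /= vE.
Qed.

Lemma linear_factor_inj A B C (j : {linear B -> C}) (u : {linear A -> C}) :
  injective j -> (forall x, exists y, j y = u x) ->
  exists v : {linear A -> B}, forall x, j (v x) = u x.
Proof.
move=> jI /choice[v vP].
have [|w wP] := @linear_bundle _ _ v.
  by move=> a x y; apply: jI; rewrite linearP !vP linearP.
by exists w => x; rewrite wP vP.
Qed.

Section Kernel.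
Variables (A B : lmodType S) (f : {linear A -> B}).

Definition ker_pred : {pred A} := fun x => f x == 0.

Lemma ker_pred_submod : subsemimod_closed ker_pred.
Proof.
split; first split.
- by rewrite unfold_in raddf0.
- by move=> x y; rewrite !unfold_in raddfD /= => /eqP-> /eqP->; rewrite addr0.
- by move=> a x; rewrite !unfold_in linearZ /= => /eqP->; rewrite scaler0.
Qed.
HB.instance Definition _ :=
  GRing.isSubmodClosed.Build S A ker_pred ker_pred_submod.

Record ker_mod := KerMod { ker_val : A; _ : ker_val \in ker_pred }.
HB.instance Definition _ := [isSub for ker_val].
HB.instance Definition _ := [Choice of ker_mod by <:].
HB.instance Definition _ := [SubChoice_isSubLmodule of ker_mod by <:].

Lemma kernel_exists :
  exists (K : lmodType S) (k : {linear K -> A}), injective k /\ exact_at k f.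
Proof.
exists ker_mod, (val : {linear ker_mod -> A}); split; first exact: val_inj.
move=> x; split => [/eqP fx0|[y <-]]; last by apply/eqP; exact: (valP y).
by exists (KerMod fx0).
Qed.
End Kernel.

Section Cokernel.
Variables (A B : lmodType S) (f : {linear A -> B}).

Definition im_pred : {pred B} := fun y => `[< exists x, f x = y >].

Lemma im_pred_zmod_closed : zmod_closed im_pred.
Proof.
split=> [|_ _ /asboolP[x <-] /asboolP[y <-]]; apply/asboolP.
  by exists 0; rewrite raddf0.
by exists (x - y); rewrite raddfB.
Qed.
HB.instance Definition _ := GRing.isZmodClosed.Build B im_pred im_pred_zmod_closed.

(** The quotient is taken on additive groups first; the scalar action is put on it afterwards
    through representatives. *)
Definition coker_mod := Quotient.quot im_pred.
HB.instance Definition _ := GRing.Zmodule.on coker_mod.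

Definition coker_pi (x : B) : coker_mod := \pi_(Quotient.quot im_pred) x.

Lemma coker_piP x y : coker_pi x = coker_pi y <-> exists z, f z = x - y.
Proof.
by split=> [/eqP|xyS]; [|apply/eqP];
  rewrite -Quotient.idealrBE; [move/asboolP|exact/asboolP].
Qed.

Lemma coker_piD : {morph coker_pi : x y / x + y}.
Proof. by move=> x y; rewrite /coker_pi raddfD. Qed.

Definition coker_scale (a : S) (x : coker_mod) : coker_mod :=
  coker_pi (a *: repr (x : Quotient.quot im_pred)).

Lemma coker_piZ a x : coker_scale a (coker_pi x) = coker_pi (a *: x).
Proof.
apply/coker_piP; have [|z zE] := (coker_piP (repr (coker_pi x)) x).1.
  by rewrite /coker_pi reprK.
by exists (a *: z); rewrite linearZ /= zE scalerBr.
Qed.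

Lemma coker_pi_surj x : exists y, coker_pi y = x.
Proof. by exists (repr (x : Quotient.quot im_pred)); rewrite /coker_pi reprK. Qed.

Lemma coker_scalerA a b x : coker_scale a (coker_scale b x) = coker_scale (a * b) x.
Proof. by have [y <-] := coker_pi_surj x; rewrite !coker_piZ scalerA. Qed.

Lemma coker_scale1r : left_id 1 coker_scale.
Proof. by move=> x; have [y <-] := coker_pi_surj x; rewrite coker_piZ scale1r. Qed.

Lemma coker_scalerDr : right_distributive coker_scale +%R.
Proof.
move=> a x x'; have [y <-] := coker_pi_surj x; have [y' <-] := coker_pi_surj x'.
by rewrite -coker_piD !coker_piZ -coker_piD scalerDr.
Qed.

Lemma coker_scalerDl x : {morph coker_scale^~ x : a b / a + b}.
Proof.
by move=> a b; have [y <-] := coker_pi_surj x; rewrite !coker_piZ -coker_piD scalerDl.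
Qed.

HB.instance Definition _ := GRing.Zmodule_isLmodule.Build S coker_mod
  coker_scalerA coker_scale1r coker_scalerDr coker_scalerDl.

Lemma cokernel_exists : exists (C : lmodType S) (q : {linear B -> C}),
  is_surjective q /\ exact_at f q.
Proof.
have [|q qE] := @linear_bundle B coker_mod coker_pi.
  by move=> a x y; rewrite coker_piD; congr (_ + _); rewrite -coker_piZ.
exists coker_mod, q; split=> [y|y].
  by have [x <-] := coker_pi_surj y; exists x.
have pi0 : 0 = coker_pi 0 by rewrite /coker_pi raddf0.
rewrite qE pi0; split=> [|[x <-]].
  by move=> /coker_piP[z]; rewrite subr0; exists z.
by apply/coker_piP; exists x; rewrite subr0.
Qed.
End Cokernel.

End LinearConstructions.

(** * Free modules *)

(** Independence of the family is encoded by the extension property: extending indicator functions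
    to maps into the ring yields coordinates. *)
Definition is_basis (S : pzRingType) (X : Type) (F : lmodType S) (e : X -> F) :=
  (forall (L : lmodType S) (phi : X -> L),
     exists h : {linear F -> L}, forall x, h (e x) = phi x) /\
  (forall y, exists s : seq (S * X), y = \sum_(c <- s) c.1 *: e c.2).

Section FreeModule.
Variables (S : pzRingType) (X : choiceType).
Implicit Type L : lmodType S.

Definition formal_eval (L : lmodType S) (phi : X -> L) (s : seq (S * X)) : L :=
  \sum_(c <- s) c.1 *: phi c.2.

(* Two formal combinations are identified when they have the same value in every
   module; the universal property of the quotient is then immediate. *)
Definition formal_eq : rel (seq (S * X)) := fun s t =>
  `[< forall (L : lmodType S) (phi : X -> L), formal_eval phi s = formal_eval phi t >].

Lemma formal_eq_equiv : equiv_class_of formal_eq.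
Proof.
split=> [s|s t|t s u /asboolP st /asboolP tu]; first exact/asboolP.
  by apply/asboolP/asboolP => st L phi; rewrite st.
by apply/asboolP => L phi; rewrite st.
Qed.
Canonical formal_eq_equivRel := EquivRelPack formal_eq_equiv.

Definition free_mod := {eq_quot formal_eq}.
HB.instance Definition _ := Choice.on free_mod.

Definition free_eval (L : lmodType S) (phi : X -> L) (x : free_mod) : L :=
  formal_eval phi (repr x).

Lemma free_eval_pi L (phi : X -> L) s :
  free_eval phi (\pi_free_mod s) = formal_eval phi s.
Proof.
by have /eqquotP/asboolP := reprK (\pi_free_mod s); apply.
Qed.

Lemma free_eval_ext (x y : free_mod) :
  (forall L (phi : X -> L), free_eval phi x = free_eval phi y) -> x = y.
Proof. by move=> xy; rewrite -(reprK x) -(reprK y); apply/eqquotP/asboolP. Qed.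

Definition free_zero : free_mod := \pi_free_mod [::].
Definition free_add (x y : free_mod) : free_mod := \pi_free_mod (repr x ++ repr y).
Definition free_scale (a : S) (x : free_mod) : free_mod :=
  \pi_free_mod [seq (a * c.1, c.2) | c <- repr x].
Definition free_opp := free_scale (- 1).

Lemma free_eval0 L (phi : X -> L) : free_eval phi free_zero = 0.
Proof. by rewrite free_eval_pi /formal_eval big_nil. Qed.

Lemma free_evalD L (phi : X -> L) x y :
  free_eval phi (free_add x y) = free_eval phi x + free_eval phi y.
Proof. by rewrite free_eval_pi /formal_eval big_cat. Qed.

Lemma free_evalZ L (phi : X -> L) a x :
  free_eval phi (free_scale a x) = a *: free_eval phi x.
Proof.
rewrite free_eval_pi /formal_eval big_map scaler_sumr.
by apply: eq_bigr => c _; rewrite scalerA.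
Qed.

Let evalE := (free_eval0, free_evalD, free_evalZ).

Lemma free_addA : associative free_add.
Proof. by move=> x y z; apply: free_eval_ext => L phi; rewrite !evalE addrA. Qed.
Lemma free_addC : commutative free_add.
Proof. by move=> x y; apply: free_eval_ext => L phi; rewrite !evalE addrC. Qed.
Lemma free_add0 : left_id free_zero free_add.
Proof. by move=> x; apply: free_eval_ext => L phi; rewrite !evalE add0r. Qed.
Lemma free_addN : left_inverse free_zero free_opp free_add.
Proof.
by move=> x; apply: free_eval_ext => L phi; rewrite !evalE scaleN1r addNr.
Qed.
HB.instance Definition _ := GRing.isZmodule.Build free_mod
  free_addA free_addC free_add0 free_addN.

Lemma free_scalerA a b x : free_scale a (free_scale b x) = free_scale (a * b) x.
Proof. by apply: free_eval_ext => L phi; rewrite !evalE scalerA. Qed.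
Lemma free_scale1r : left_id 1 free_scale.
Proof. by move=> x; apply: free_eval_ext => L phi; rewrite !evalE scale1r. Qed.
Lemma free_scalerDr : right_distributive free_scale +%R.
Proof.
by move=> a x y; apply: free_eval_ext => L phi; rewrite !evalE scalerDr.
Qed.
Lemma free_scalerDl x : {morph free_scale^~ x : a b / a + b}.
Proof.
by move=> a b; apply: free_eval_ext => L phi; rewrite !evalE scalerDl.
Qed.
HB.instance Definition _ := GRing.Zmodule_isLmodule.Build S free_mod
  free_scalerA free_scale1r free_scalerDr free_scalerDl.

Lemma free_eval_linear L (phi : X -> L) : linear (free_eval phi).
Proof. by move=> a x y; rewrite free_evalD free_evalZ. Qed.

Lemma basis_exists : exists (F : lmodType S) (e : X -> F), is_basis e.
Proof.
pose e x : free_mod := \pi_free_mod [:: (1, x)].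
have eE L (phi : X -> L) x : free_eval phi (e x) = phi x.
  by rewrite free_eval_pi /formal_eval big_seq1 scale1r.
exists free_mod, e; split=> [L phi|y].
  have [h hE] := linear_bundle (free_eval_linear phi).
  by exists h => x; rewrite hE eE.
exists (repr y); apply: free_eval_ext => L phi.
have [h hE] := linear_bundle (free_eval_linear phi).
rewrite -[RHS]hE linear_sum; apply: eq_bigr => c _.
by rewrite linearZ /= hE eE.
Qed.
End FreeModule.

Lemma basis_projective (S : pzRingType) (X : Type) (F : lmodType S) (e : X -> F) :
  is_basis e -> is_projective F.
Proof.
move=> [univ gen] A B p f psurj.
have /choice[phi phiE] : forall x, exists a, p a = f (e x) by move=> x; apply: psurj.
have [h hE] := univ _ phi; exists h => y; have [s ->] := gen y.
by rewrite !linear_sum; apply: eq_bigr => c _; rewrite !linearZ /= hE phiE.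
Qed.

Lemma free_cover (S : pzRingType) (M : lmodType S) :
  exists (F : lmodType S) (e : M -> F) (p : {linear F -> M}),
    is_basis e /\ is_surjective p.
Proof.
have [F [e eB]] := basis_exists S M.
have [p pE] := eB.1 M id; exists F, e, p; split=> // y.
by exists (e y).
Qed.

(** * Enough injectives *)

Definition divisible (D : zmodType) :=
  forall (n : nat) (d : D), (0 < n)%N -> exists e, e *+ n = d.

(* The graph of a homomorphism from a subgroup of B to D. *)
Definition partial_hom (B D : zmodType) (G : set (B * D)) :=
  is_subgroup G /\ forall d, G (0, d) -> d = 0.

Lemma pairMz (B D : zmodType) (x : B * D) (n : int) : x *~ n = (x.1 *~ n, x.2 *~ n).
Proof. by case: n => n; rewrite /intmul pairMnE. Qed.

Section PartialHom.
Variables (B D : zmodType).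
Hypothesis Ddiv : divisible D.
Implicit Type G : set (B * D).

(** If a positive multiple of [b] lies in the domain of [G], take the least one, [b *+ m], and
    divide its value by [m]; all multiples of [b] in the domain are then multiples of [b *+ m].
    Otherwise any value will do. *)
Lemma partial_hom_value G b : partial_hom G ->
  exists d, forall (n : int) e, G (b *~ n, e) -> e = d *~ n.
Proof.
move=> Gh; have [Gsub Gf] := Gh; have [G0 GB] := Gsub.
have [exG|noG] := pselect (exists n, `[< (0 < n)%N /\ exists e, G (b *+ n, e) >]).
  have [m /asboolP[m_gt0 [e0 Ge0]] minm] := ex_minnP exG; have [d dE] := Ddiv e0 m_gt0.
  (* Division with remainder: [b *~ r] is again in the domain, so minimality of [m] forces
     [r = 0]. *)
  exists d => n e Gne; pose q := (n %/ m)%Z; pose r := (n %% m)%Z.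
  have Gr : G (b *~ r, e - e0 *~ q).
    have /(GB _ _ Gne) := subgroupMz Gsub q Ge0.
    rewrite pmulrn pairMz -[_ - _]/(b *~ n - b *~ m *~ q, e - e0 *~ q).
    rewrite -mulrzA -mulrzBr /r [n in n - _](divz_eq n m) -/q mulrC.
    by rewrite [_ + _ - _]addrAC subrr add0r.
  have r_ge0 : 0 <= r by rewrite modz_ge0 // gt_eqF.
  have r_lt : r < m by rewrite ltz_pmod.
  have r0 : r = 0.
    case: r Gr r_ge0 r_lt => // r Gr _ r_lt; case: (posnP r) => [->//|r_gt0].
    rewrite ltz_nat in r_lt; suff : (m <= r)%N by rewrite leqNgt r_lt.
    apply: minm.
    by apply/asboolP; split=> //; exists (e - e0 *~ q).
  move: Gr; rewrite r0 => /Gf/eqP; rewrite subr_eq0 => /eqP ->.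
  by rewrite -dE pmulrn -mulrzA (divz_eq n m) -/q -/r r0 addr0 mulrC.
(* Only [n = 0] can occur: a negative [n] becomes positive on passing to opposites. *)
exists 0 => n e Gne; rewrite mul0rz.
have pos k e' : G (b *+ k.+1, e') -> False.
  by move=> Gk; apply: noG; exists k.+1; apply/asboolP; split=> //; exists e'.
case: n Gne => [[|n]|n] Gne; [exact: Gf| by case: (pos n e)|].
case: (pos n (- e)).
by have := GB _ _ G0 Gne; rewrite sub0r NegzE mulrNz -[X in G X]/(_, _) opprK.
Qed.

(** [G'] is the sum of [G] and the subgroup generated by [(b, d)]. It stays single-valued because
    [d] agrees with every value that [G] gives at a multiple of [b]. *)
Lemma partial_hom_extend G b : partial_hom G ->
  exists G', [/\ partial_hom G', (G `<=` G')%classic & exists d, G' (b, d)].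
Proof.
move=> Gh; have [[G0 GB] Gf] := Gh; have [d dP] := partial_hom_value b Gh.
exists [set x : B * D | exists n : int, G (x - (b, d) *~ n)]%classic; split.
- split; first split.
  + by exists 0; rewrite subr0.
  + move=> x y [n Gx] [m Gy]; exists (n - m).
    by have := GB _ _ Gx Gy; rewrite mulrzBr [in X in _ -> X]opprD addrACA -opprD.
  + move=> e [n]; rewrite pairMz => /=.
    rewrite -[X in G X]/(0 - b *~ n, e - d *~ n) sub0r -mulrNz => /dP.
    by rewrite mulrNz => eN; apply: (addIr (- (d *~ n))); rewrite add0r.
- by move=> x Gx; exists 0; rewrite subr0.
- by exists d, 1; rewrite subrr.
Qed.

Lemma partial_hom_total G : partial_hom G ->
  exists h : B -> D, zmod_morphism h /\ forall b d, G (b, d) -> h b = d.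
Proof.
(* Zorn's lemma is applied to the sets added to [G] rather than to the graphs containing [G], so
   that the empty chain also has its union in [P]. *)
move=> Gh; pose P := [set A | partial_hom (G `|` A)]%classic.
have [F FP Ftot|A [AP Amax]] := Zorn_bigcup (P := P).
  (* The conditions on a graph involve at most two elements, and two elements of the union lie in
     one member because the chain is total. *)
  have pair x y : (G `|` \bigcup_(X in F) X)%classic x ->
      (G `|` \bigcup_(X in F) X)%classic y ->
      exists Z, [/\ partial_hom Z, Z x, Z y & (Z `<=` G `|` \bigcup_(X in F) X)%classic].
    have sub X : F X -> (G `|` X `<=` G `|` \bigcup_(X in F) X)%classic.
      by move=> FX; apply: setUS => z Xz; exists X.
    move=> [Gx|[X FX Xx]] [Gy|[Y FY Yy]].
    - by exists G; split=> //; apply: subsetUl.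
    - by exists (G `|` Y)%classic; split; [exact: FP|left|right|exact: sub].
    - by exists (G `|` X)%classic; split; [exact: FP|right|left|exact: sub].
    - have [XY|YX] := Ftot _ _ FX FY.
        by exists (G `|` Y)%classic; split; [exact: FP|right; apply: XY|right|exact: sub].
      by exists (G `|` X)%classic; split; [exact: FP|right|right; apply: YX|exact: sub].
  split; first split.
  - by left; case: Gh => -[].
  - by move=> x y Ux Uy; have [Z [[[_ ZB] _] Zx Zy]] := pair _ _ Ux Uy; apply; apply: ZB.
  - by move=> d Ud; have [Z [[_ Zf] Zx _ _]] := pair _ _ Ud Ud; apply: Zf.
(* A point outside the domain of the maximal graph would allow a proper extension. *)
have /choice[h hP] : forall b, exists d, (G `|` A)%classic (b, d).
  move=> b; have [G' [G'h GG' [d G'bd]]] := partial_hom_extend b AP.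
  exists d; apply: contrapT => nGA; apply: (Amax G').
    split; last by move=> /(_ _ G'bd) Abd; apply: nGA; right.
    by move=> x Ax; apply: GG'; right.
  have GG'U : (G `<=` G')%classic by move=> x Gx; apply: GG'; left.
  by rewrite /P /= ((setUidPr _ _).2 GG'U).
case: AP => -[_ UB] Uf.
have uniq b d d' : (G `|` A)%classic (b, d) -> (G `|` A)%classic (b, d') -> d = d'.
  move=> Ud Ud'; apply/eqP; rewrite -subr_eq0; apply/eqP/Uf.
  by have := UB _ _ Ud Ud'; rewrite -[(b, d) - _]/(b - b, d - d') subrr.
exists h; split=> [x y|b d Gbd]; last by apply: uniq (hP b) _; left.
by apply: uniq (hP _) _; apply: (UB _ _ (hP x) (hP y)).
Qed.

End PartialHom.

(** * Rationals modulo integers, and characters with values in them *)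

Section RatModInt.

Definition int_rat : {pred rat} := fun x => `[< exists n : int, x = n%:~R >].

Lemma int_rat_zmod_closed : zmod_closed int_rat.
Proof.
split=> [|_ _ /asboolP[n ->] /asboolP[m ->]]; apply/asboolP; first by exists 0.
by exists (n - m); rewrite intrB.
Qed.
HB.instance Definition _ := GRing.isZmodClosed.Build rat int_rat int_rat_zmod_closed.

Definition rat_mod_int := Quotient.quot int_rat.
HB.instance Definition _ := GRing.Zmodule.on rat_mod_int.

Lemma rat_mod_int_divisible : divisible rat_mod_int.
Proof.
move=> n d n_gt0; exists (\pi_rat_mod_int (repr d / n%:R)).
rewrite -raddfMn -[_ *+ n]mulr_natr divfK; last by rewrite pnatr_eq0 -lt0n.
exact: reprK.
Qed.

(** Send [x] to the class of a suitable rational [q]; this defines a character on the subgroup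
    generated by [x], which extends to [N] by divisibility. *)
Lemma separating_character (N : zmodType) (x : N) : x != 0 ->
  exists h : N -> rat_mod_int, zmod_morphism h /\ h x != 0.
Proof.
move=> x0.
(* Take one half when [x] has infinite order, and the inverse of [m] when [x] has finite order
   [m]. *)
have [q qZ qP] : exists2 q : rat, q \notin int_rat &
    forall k : int, x *~ k = 0 -> q *~ k \in int_rat.
  have inv_notin m : (1 < m)%N -> (m%:R^-1 : rat) \notin int_rat.
    move=> m_gt1; apply/asboolP => -[k mk].
    have m0 : (m%:R : rat) != 0 by rewrite pnatr_eq0; case: m m_gt1 {mk}.
    have /eqP : (k * m)%:~R = 1 :> rat by rewrite intrM -mk mulVf.
    rewrite -[1]/(1%:~R) eqr_int => /eqP/(congr1 absz).
    rewrite abszM /= => /eqP; rewrite muln_eq1 => /andP[_ /eqP m1].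
    by rewrite m1 in m_gt1.
  have [ord|noord] := pselect (exists n, (0 < n)%N && (x *+ n == 0)); last first.
    exists 2%:R^-1; first exact: inv_notin.
    have pos k : x *+ k.+1 = 0 -> False.
      by move=> xk; apply: noord; exists k.+1; rewrite xk eqxx.
    case=> [[|k]|k]; first by move=> _; apply/asboolP; exists 0.
      by move=> /pos.
    by rewrite NegzE mulrNz => /eqP; rewrite oppr_eq0 => /eqP/pos.
  have [m /andP[m_gt0 /eqP xm] minm] := ex_minnP ord.
  have m_gt1 : (1 < m)%N.
    case: m m_gt0 xm {minm} => [|[|m]] // _.
    by rewrite mulr1n => /eqP; rewrite (negPf x0).
  exists m%:R^-1; first exact: inv_notin.
  move=> k xk; apply/asboolP; exists (k %/ m)%Z.
  have km0 : (k %% m)%Z = 0.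
    have : x *~ (k %% m)%Z = 0.
      have := xk; rewrite {1}(divz_eq k m) mulrzDr mulrC mulrzA.
      by rewrite -pmulrn xm mul0rz add0r.
    have : 0 <= (k %% m)%Z by rewrite modz_ge0 // gt_eqF.
    have : (k %% m)%Z < m by rewrite ltz_pmod.
    case: (k %% m)%Z => // r; rewrite ltz_nat => r_lt _ xr.
    case: (posnP r) => [->//|r_gt0].
    suff : (m <= r)%N by rewrite leqNgt r_lt.
    by apply: minm; rewrite r_gt0 pmulrn xr eqxx.
  rewrite {1}(divz_eq k m) km0 addr0 mulrzA mulrzAC -pmulrn.
  rewrite -[_^-1 *+ m]mulr_natr mulVf //.
  by rewrite pnatr_eq0 -lt0n.
pose d : rat_mod_int := \pi_rat_mod_int q.
pose G := [set y | exists k : int, y = (x, d) *~ k]%classic.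
have pi0 (y : rat) : (\pi_rat_mod_int y == 0) = (y \in int_rat).
  by rewrite -[y in RHS]subr0 Quotient.idealrBE raddf0.
have [|h [hadd hP]] := partial_hom_total rat_mod_int_divisible (G := G).
  split; first split=> [|_ _ [k ->] [l ->]]; first by exists 0.
    by exists (k - l); rewrite mulrzBr.
  move=> e [k]; rewrite pairMz => -[/esym/qP kq ->].
  by apply/eqP; rewrite -raddfMz pi0.
exists h; split=> //; rewrite (hP x d) //; last by exists 1.
by rewrite pi0.
Qed.

End RatModInt.

(** * Coinduced modules: additive maps from the ring to an abelian group *)

Section Coinduction.
Variables (S : pzRingType) (D : zmodType).

Definition coind_pred : {pred (S -> D)} := fun f => `[< zmod_morphism f >].

Lemma coind_pred_zmod_closed : zmod_closed coind_pred.
Proof.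
split=> [|f g /asboolP fB /asboolP gB]; apply/asboolP => x y /=.
  by rewrite subr0.
rewrite -[(f - g) (x - y)]/(f (x - y) - g (x - y)) -[(f - g) x]/(f x - g x).
rewrite -[(f - g) y]/(f y - g y) fB gB.
by rewrite [in LHS](opprD (g x)) addrACA -opprD.
Qed.
HB.instance Definition _ :=
  GRing.isZmodClosed.Build (S -> D) coind_pred coind_pred_zmod_closed.

Record coind := Coind { coind_fun : S -> D; _ : coind_fun \in coind_pred }.
HB.instance Definition _ := [isSub for coind_fun].
HB.instance Definition _ := [Choice of coind by <:].
HB.instance Definition _ := [SubChoice_isSubZmodule of coind by <:].

Lemma coindB (f : coind) : zmod_morphism (coind_fun f).
Proof. by case: f => f /= /asboolP. Qed.

Lemma coindD (f : coind) : {morph coind_fun f : x y / x + y}.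
Proof.
have f0 : coind_fun f 0 = 0 by have := coindB f 0 0; rewrite !subrr.
have fN x : coind_fun f (- x) = - coind_fun f x by rewrite -[- x]sub0r coindB f0 sub0r.
by move=> x y; rewrite -[y in LHS]opprK coindB fN opprK.
Qed.

Lemma coind_ext (f g : coind) : coind_fun f =1 coind_fun g -> f = g.
Proof. by move=> /funext fg; apply: val_inj. Qed.

(** Multiplication on the right in the argument is what gives a left action on the maps, also over a
    noncommutative ring. *)
Lemma coind_scale_proof (a : S) (f : coind) :
  (fun r => coind_fun f (r * a)) \in coind_pred.
Proof. by apply/asboolP => x y; rewrite mulrBl coindB. Qed.
Definition coind_scale a f := Coind (coind_scale_proof a f).

Lemma coind_scalerA a b f : coind_scale a (coind_scale b f) = coind_scale (a * b) f.
Proof. by apply: coind_ext => r /=; rewrite mulrA. Qed.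
Lemma coind_scale1r : left_id 1 coind_scale.
Proof. by move=> f; apply: coind_ext => r /=; rewrite mulr1. Qed.
Lemma coind_scalerDr : right_distributive coind_scale +%R.
Proof. by move=> a f g; apply: coind_ext. Qed.
Lemma coind_scalerDl f : {morph coind_scale^~ f : a b / a + b}.
Proof. by move=> a b; apply: coind_ext => r /=; rewrite mulrDr coindD. Qed.
HB.instance Definition _ := GRing.Zmodule_isLmodule.Build S coind
  coind_scalerA coind_scale1r coind_scalerDr coind_scalerDl.

(** One half of the adjunction with the forgetful functor to abelian groups; [h] is recovered by
    evaluation at [1]. *)
Lemma coind_lift (A : lmodType S) (h : A -> D) : zmod_morphism h ->
  exists f : {linear A -> coind}, forall a r, coind_fun (f a) r = h (r *: a).
Proof.
move=> hB.
have fP a : (fun r : S => h (r *: a)) \in coind_pred.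
  by apply/asboolP => x y; rewrite scalerBl hB.
have h0 : h 0 = 0 by have := hB 0 0; rewrite !subrr.
have hD x y : h (x + y) = h x + h y.
  by rewrite -[y in LHS]opprK hB -[- y]sub0r hB h0 sub0r opprK.
have [|f fE] := @linear_bundle _ A coind (fun a => Coind (fP a)).
  by move=> a x y; apply: coind_ext => r /=; rewrite scalerDr scalerA hD.
by exists f => a r; rewrite fE.
Qed.

(** By the adjunction, extending [f] along [i] amounts to extending the additive map [phi], which
    divisibility of [D] allows. *)
Lemma coind_injective : divisible D -> is_injective coind.
Proof.
move=> Ddiv A B i f iI; pose phi a := coind_fun (f a) 1.
have phiB : zmod_morphism phi by move=> x y; rewrite /phi raddfB.
(* The graph of [phi] transported to the image of [i]; it is single-valued since [i] is
   injective. *)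
pose G := [set (i a, phi a) | a in setT]%classic.
have [|h [hB hP]] := partial_hom_total Ddiv (G := G).
  split; first split=> [|_ _ [a _ <-] [b _ <-]].
  - by exists 0; rewrite // raddf0 /phi raddf0.
  - by exists (a - b); rewrite // raddfB phiB.
  - move=> d [a _ [ia0 <-]].
    by have -> : a = 0; [apply: iI; rewrite raddf0 | rewrite /phi raddf0].
have [g gE] := coind_lift hB; exists g => x; apply: coind_ext => r.
rewrite gE -linearZ (hP _ (phi (r *: x))); last by exists (r *: x).
by rewrite /phi linearZ /= mul1r.
Qed.

End Coinduction.

(** [N] is mapped to the module coinduced from a product of copies of the rationals modulo integers,
    one for each element of [N]. The factor indexed by [y] carries a character that is nonzero at
    [y] if [y] is, whence injectivity. *)
Lemma injective_embedding (S : pzRingType) (N : lmodType S) :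
  exists (E : lmodType S) (j : {linear N -> E}), is_injective E /\ injective j.
Proof.
have /choice[chi chiP] : forall x : N, exists h : N -> rat_mod_int,
    zmod_morphism h /\ (x != 0 -> h x != 0).
  move=> x; have [->|x0] := eqVneq x 0; last first.
    by have [h [hB hx]] := separating_character x0; exists h.
  by exists (fun _ => 0); split=> // ? ?; rewrite subr0.
pose h (y : N) : N -> rat_mod_int := fun x => chi x y.
have [|j jE] := @coind_lift S (N -> rat_mod_int) N h.
  by move=> y z; apply/funext => x; exact: (chiP x).1.
exists (coind S (N -> rat_mod_int)), j; split.
  apply: coind_injective => n d n_gt0.
  have /choice[e eP] x := rat_mod_int_divisible (d x) n_gt0.
  exists e; apply/funext => x; rewrite -eP.
  by elim: (n) => [//|k IH]; rewrite !mulrS -IH.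
apply: raddf_inj => y jy0; apply/eqP/negPn/negP => y0.
have := (chiP y).2 y0; rewrite -[chi y y]/(h y y) -[y in h y]scale1r -jE jy0.
by rewrite eqxx.
Qed.

(** * Dimension shifting *)

Section DimensionShifting.
Variable S : pzRingType.
Implicit Types K P M N E C : lmodType S.

Definition extends K P (i : {linear K -> P}) N :=
  forall f : {linear K -> N}, exists g : {linear P -> N}, forall x, g (i x) = f x.

Definition lifts E C (q : {linear E -> C}) M :=
  forall f : {linear M -> C}, exists g : {linear M -> E}, forall x, q (g x) = f x.

(** For [M] the cokernel of [i] and [N] the kernel of [q], with [P] projective and [E] injective,
    both conditions mean Ext^2(M, N) = 0, read as Ext^1(K, N) and as Ext^1(M, C). This direction
    rests on injectivity of [E], the next lemma on projectivity of [P]. *)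
Lemma extends_of_lifts K P C E (i : {linear K -> P}) (q : {linear E -> C}) :
  injective i -> is_injective E -> lifts q K -> extends i C.
Proof.
move=> iI Einj qK f; have [g gE] := qK f; have [h hE] := Einj _ _ i g iI.
by exists (q \o h) => x /=; rewrite hE gE.
Qed.

Lemma lifts_of_extends K P C E (i : {linear K -> P}) (q : {linear E -> C}) :
  is_surjective q -> is_projective P -> extends i C -> lifts q K.
Proof.
move=> qS Pproj iC f; have [g gE] := iC f; have [h hE] := Pproj _ _ q g qS.
by exists (h \o i) => x /=; rewrite hE gE.
Qed.

Section Balance.
Variables (K P M N E C : lmodType S).
Variables (i : {linear K -> P}) (p : {linear P -> M}).
Variables (j : {linear N -> E}) (q : {linear E -> C}).
Hypotheses (ip : short_exact i p) (jq : short_exact j q).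

Lemma short_exact_comp0 x : p (i x) = 0.
Proof. by apply/(se_exact ip); exists x. Qed.

(* Both properties express that Ext^1(M, N) vanishes. *)
Lemma lifts_of_extends_ses : is_projective P -> extends i N -> lifts q M.
Proof.
move=> Pproj iN f; have [iI ipE pS] := ip; have [jI jqE qS] := jq.
have [g gE] := Pproj _ _ q (f \o p) qS.
have [|g0 g0E] := linear_factor_inj (u := g \o i) jI.
  by move=> x; apply/jqE; rewrite /= gE /= short_exact_comp0 raddf0.
(* Subtracting [j \o g1] from [g] makes it vanish on the image of [i], so that it descends to [M];
   composition with [q] is unchanged. *)
have [g1 g1E] := iN g0.
have [|v vE] := linear_factor_surj (u := g \- (j \o g1)) pS.
  by move=> _ /ipE[x <-]; rewrite /= g1E g0E /= subrr.
exists v => m; have [x <-] := pS m; rewrite vE /= raddfB /= gE.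
by rewrite [X in _ - X](_ : _ = 0) ?subr0 //; apply/jqE; exists (g1 x).
Qed.

Lemma extends_of_lifts_ses : is_injective E -> lifts q M -> extends i N.
Proof.
move=> Einj qM f; have [iI ipE pS] := ip; have [jI jqE qS] := jq.
have [g gE] := Einj _ _ i (j \o f) iI.
have [|v vE] := linear_factor_surj (u := q \o g) pS.
  by move=> _ /ipE[x <-] /=; rewrite gE /=; apply/jqE; exists (f x).
have [w wE] := qM v.
have [|g1 g1E] := linear_factor_inj (u := g \- (w \o p)) jI.
  by move=> x; apply/jqE; rewrite /= raddfB /= wE vE /= subrr.
exists g1 => x; apply: jI.
by rewrite g1E /= gE short_exact_comp0 raddf0 subr0.
Qed.

(** A lift of the identity splits [q], so [j] has a retraction [r] and [N] is a direct summand of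
    [E]. *)
Lemma lifts_id_injective : is_injective E -> lifts q C -> is_injective N.
Proof.
move=> Einj qC; have [jI jqE qS] := jq; have [s sE] := qC idfun.
have [|r rE] := linear_factor_inj (u := idfun \- (s \o q)) jI.
  by move=> x; apply/jqE; rewrite /= raddfB /= sE subrr.
have rK x : r (j x) = x.
  have qj : q (j x) = 0 by apply/jqE; exists x.
  by apply: jI; rewrite rE /= qj raddf0 subr0.
move=> A B k f kI; have [h hE] := Einj _ _ k (j \o f) kI.
by exists (r \o h) => x /=; rewrite hE /= rK.
Qed.

Lemma extends_id_projective : is_projective P -> extends i K -> is_projective M.
Proof.
move=> Pproj iK; have [iI ipE pS] := ip; have [r rE] := iK idfun.
have [|s sE] := linear_factor_surj (u := idfun \- (i \o r)) pS.
  by move=> _ /ipE[x <-]; rewrite /= rE subrr.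
have sK m : p (s m) = m.
  have [x <-] := pS m; rewrite sE /= raddfB /= [X in _ - X](_ : _ = 0) ?subr0 //.
  exact: short_exact_comp0.
move=> A B k f kS; have [h hE] := Pproj _ _ k (f \o p) kS.
by exists (h \o s) => x /=; rewrite hE /= sK.
Qed.

End Balance.

(** Bounds the projective dimension by recursion on syzygies instead of whole resolutions, so that
    an induction handles one short exact sequence at a time. *)
Fixpoint pd_le (n : nat) (M : lmodType S) : Prop :=
  if n is m.+1 then
    exists (K P : lmodType S) (i : {linear K -> P}) (p : {linear P -> M}),
      [/\ short_exact i p, is_projective P & pd_le m K]
  else is_projective M.

Fixpoint id_le (n : nat) (N : lmodType S) : Prop :=
  if n is m.+1 then
    exists (E C : lmodType S) (j : {linear N -> E}) (q : {linear E -> C}),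
      [/\ short_exact j q, is_injective E & id_le m C]
  else is_injective N.

Lemma bijective_projective P M (p : {linear P -> M}) :
  injective p -> is_surjective p -> is_projective P -> is_projective M.
Proof.
move=> pI pS Pproj A B k f kS; have [h hE] := Pproj _ _ k (f \o p) kS.
have [x|v vE] := linear_factor_surj (u := h) pS.
  by rewrite -(raddf0 p) => /pI ->; rewrite raddf0.
by exists v => m; have [x <-] := pS m; rewrite vE hE.
Qed.

Lemma bijective_injective N E (j : {linear N -> E}) :
  injective j -> is_surjective j -> is_injective E -> is_injective N.
Proof.
move=> jI jS Einj A B k f kI; have [h hE] := Einj _ _ k (j \o f) kI.
have [|v vE] := linear_factor_inj (u := h) jI; first by move=> x; apply: jS.
by exists v => x; apply: jI; rewrite vE hE.
Qed.

(** Splits off the first short exact sequence of a resolution; the map [a] is the augmentation that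
    makes the rest a resolution of [K]. *)
Lemma resolution_syzygy M (P : left_resolution M) :
  exists (K : lmodType S) (k : {linear K -> P 0%N}) (a : {linear P 1%N -> K}),
    [/\ short_exact k (lres_aug P), is_surjective a, exact_at (lres_d P 1) a &
        forall x, k (a x) = lres_d P 0 x].
Proof.
have [K [k [kI kE]]] := kernel_exists (lres_aug P).
have [x|a aE] := linear_factor_inj (u := lres_d P 0) kI.
  by apply/kE/(@lres_exact0 _ _ P); exists x.
exists K, k, a; split=> // [|y|y]; first by split=> //; apply: lres_aug_surj.
  have /kE/(@lres_exact0 _ _ P)[x xE] : exists z, k z = k y by exists y.
  by exists x; apply: kI; rewrite aE xE.
rewrite -(@lres_exactS _ _ P 0 y) -aE; split=> [->|]; first exact: raddf0.
by rewrite -(raddf0 k) => /kI.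
Qed.

Lemma resolution_pd_le n M (P : left_resolution M) :
  (forall k, is_projective (P k)) -> length_le P n -> pd_le n M.
Proof.
elim: n M P => [|n IH] M P Pproj Plen.
  (* Length [0] makes [P 1] vanish, so the augmentation is an isomorphism. *)
  apply: (bijective_projective _ (lres_aug_surj P) (Pproj 0%N)).
  apply: raddf_inj => x /(@lres_exact0 _ _ P)[y <-].
  by rewrite (Plen 1%N isT y) raddf0.
have [K [k [a [kP aS aE _]]]] := resolution_syzygy P.
exists K, (P 0%N), k, (lres_aug P); split=> //.
pose Q := @LeftResolution S K (fun k => P k.+1) (fun k => lres_d P k.+1) a aS aE
  (fun k => @lres_exactS _ _ P k.+1).
by apply: (IH K Q) => [l|l nl]; [apply: Pproj | apply: (Plen l.+1)].
Qed.

Lemma resolution_id_le n N (E : right_resolution N) :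
  (forall k, is_injective (E k)) -> length_le E n -> id_le n N.
Proof.
elim: n N E => [|n IH] N E Einj Elen.
  apply: (bijective_injective (@rres_aug_inj _ _ E) _ (Einj 0%N)).
  by move=> y; apply/(@rres_exact0 _ _ E)/(Elen 1%N).
have [C [q [qS qE]]] := cokernel_exists (rres_aug E).
exists (E 0%N), C, (rres_aug E), q; split=> //.
  by split=> //; apply: rres_aug_inj.
have [x|a aE] := linear_factor_surj (u := rres_d E 0) qS.
  by move=> /qE/(@rres_exact0 _ _ E).
have aI : injective a.
  apply: raddf_inj => y; have [x <-] := qS y.
  by rewrite /= aE => /(@rres_exact0 _ _ E)/qE.
have aE0 : exact_at a (rres_d E 1).
  move=> y; rewrite (@rres_exactS _ _ E 0 y); split=> [[x <-]|[z <-]].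
    by exists (q x).
  by have [x <-] := qS z; exists x.
pose Q := @RightResolution S C (fun k => E k.+1) (fun k => rres_d E k.+1) a aI aE0
  (fun k => @rres_exactS _ _ E k.+1).
by apply: (IH C Q) => [l|l nl]; [apply: Einj | apply: (Elen l.+1)].
Qed.

Record proj_cover M := ProjCover {
  pc_ker : lmodType S;
  pc_obj : lmodType S;
  pc_i : {linear pc_ker -> pc_obj};
  pc_p : {linear pc_obj -> M};
  pc_exact : short_exact pc_i pc_p;
  pc_proj : is_projective pc_obj;
  (* A projective module is covered by itself, so that the resolution built from
     these covers stops as soon as possible. *)
  pc_min : is_projective M -> injective pc_p }.

Lemma proj_cover_exists M : inhabited (proj_cover M).
Proof.
have [P [p [Pproj pS pI]]] : exists (P : lmodType S) (p : {linear P -> M}),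
    [/\ is_projective P, is_surjective p & is_projective M -> injective p].
  have [Mproj|nMproj] := pselect (is_projective M).
    by exists M, idfun; split=> // x; exists x.
  have [F [e [p [eB pS]]]] := free_cover M.
  by exists F, p; split=> //; apply: basis_projective eB.
have [K [k [kI kE]]] := kernel_exists p.
by constructor; apply: (@ProjCover M K P k p).
Qed.

Definition projcover M : proj_cover M := inhabited_witness (proj_cover_exists M).

(** Any embedding into an injective module, not necessarily essential despite the name. [ih_min]
    makes it an isomorphism when [N] is already injective, so that the resolution built from these
    embeddings stops. *)
Record inj_hull N := InjHull {
  ih_obj : lmodType S;
  ih_coker : lmodType S;
  ih_j : {linear N -> ih_obj};
  ih_q : {linear ih_obj -> ih_coker};
  ih_exact : short_exact ih_j ih_q;
  ih_inj : is_injective ih_obj;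
  ih_min : is_injective N -> is_surjective ih_j }.

Lemma inj_hull_exists N : inhabited (inj_hull N).
Proof.
have [E [j [Einj jI jS]]] : exists (E : lmodType S) (j : {linear N -> E}),
    [/\ is_injective E, injective j & is_injective N -> is_surjective j].
  have [Ninj|nNinj] := pselect (is_injective N).
    by exists N, idfun; split=> // _ x; exists x.
  by have [E [j [Einj jI]]] := injective_embedding N; exists E, j; split.
have [C [q [qS qE]]] := cokernel_exists j.
by constructor; apply: (@InjHull N E C j q).
Qed.

Definition injhull N : inj_hull N := inhabited_witness (inj_hull_exists N).

Fixpoint syzygy M n : lmodType S :=
  if n is m.+1 then pc_ker (projcover (syzygy M m)) else M.

Fixpoint cosyzygy N n : lmodType S :=
  if n is m.+1 then ih_coker (injhull (cosyzygy N m)) else N.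

Lemma zero_projective M : (forall x : M, x = 0) -> is_projective M.
Proof.
move=> M0 A B p f _; have [|h hE] := @linear_bundle _ M A (fun _ => 0).
  by move=> a x y; rewrite scaler0 addr0.
by exists h => x; rewrite (M0 x) !raddf0.
Qed.

Lemma zero_injective M : (forall x : M, x = 0) -> is_injective M.
Proof.
move=> M0 A B i f _; have [|h hE] := @linear_bundle _ B M (fun _ => 0).
  by move=> a x y; rewrite scaler0 addr0.
by exists h => x; rewrite [LHS]M0 [RHS]M0.
Qed.

(** The chosen covers are spliced together. Once a syzygy is projective its cover is an isomorphism,
    so the next syzygy is zero; a zero module is projective, so all later terms vanish as well. *)
Lemma syzygy_resolution n M : is_projective (syzygy M n) ->
  exists P : left_resolution M, (forall k, is_projective (P k)) /\ length_le P n.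
Proof.
move=> Kproj; pose c k := projcover (syzygy M k).
pose d k : {linear pc_obj (c k.+1) -> pc_obj (c k)} := pc_i (c k) \o pc_p (c k.+1).
have dE k : exact_at (d k) (pc_p (c k)).
  move=> y; rewrite (se_exact (pc_exact (c k)) y); split=> [[x <-]|[z <-]].
    by have [z <-] := se_surj (pc_exact (c k.+1)) x; exists z.
  by exists (pc_p (c k.+1) z).
have dES k : exact_at (d k.+1) (d k).
  move=> y; rewrite -(dE k.+1 y) /=; split=> [|->]; last exact: raddf0.
  by rewrite -(raddf0 (pc_i (c k))) => /(se_inj (pc_exact (c k))).
exists (LeftResolution (se_surj (pc_exact (c 0%N))) (dE 0%N) dES).
split=> [k|k nk x]; first exact: pc_proj.
have Ksucc m : is_projective (syzygy M m) -> forall y : syzygy M m.+1, y = 0.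
  move=> Kmproj y; apply: (se_inj (pc_exact (c m))); apply: (pc_min Kmproj).
  by rewrite !raddf0; apply: short_exact_comp0 (pc_exact (c m)) y.
have K0 : forall y : syzygy M k, y = 0.
  elim: k nk {x} => // k IH nk; apply: Ksucc; move: nk; rewrite ltnS leq_eqVlt.
  by case/orP => [/eqP <-//|/IH]; apply: zero_projective.
apply: (pc_min (zero_projective K0)).
by rewrite raddf0; apply: K0.
Qed.

Lemma cosyzygy_resolution n N : is_injective (cosyzygy N n) ->
  exists E : right_resolution N, (forall k, is_injective (E k)) /\ length_le E n.
Proof.
move=> Cinj; pose c k := injhull (cosyzygy N k).
pose d k : {linear ih_obj (c k) -> ih_obj (c k.+1)} := ih_j (c k.+1) \o ih_q (c k).
have dE k : exact_at (ih_j (c k)) (d k).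
  move=> y; rewrite -(se_exact (ih_exact (c k)) y) /=; split=> [|->].
    by rewrite -(raddf0 (ih_j (c k.+1))) => /(se_inj (ih_exact (c k.+1))).
  exact: raddf0.
have dES k : exact_at (d k) (d k.+1).
  move=> y; rewrite (dE k.+1 y) /=; split=> [[x <-]|[z <-]].
    by have [z <-] := se_surj (ih_exact (c k)) x; exists z.
  by exists (ih_q (c k) z).
exists (RightResolution (se_inj (ih_exact (c 0%N))) (dE 0%N) dES).
split=> [k|k nk x]; first exact: ih_inj.
have Csucc m : is_injective (cosyzygy N m) -> forall y : cosyzygy N m.+1, y = 0.
  move=> Cminj y; have [z <-] := se_surj (ih_exact (c m)) y.
  have [w <-] := ih_min (i := c m) Cminj z.
  exact: short_exact_comp0 (ih_exact (c m)) w.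
have C0 : forall y : cosyzygy N k, y = 0.
  elim: k nk {x} => // k IH nk; apply: Csucc; move: nk; rewrite ltnS leq_eqVlt.
  by case/orP => [/eqP <-//|/IH]; apply: zero_injective.
have [y <-] := ih_min (i := c k) (zero_injective C0) x.
by rewrite (C0 y) raddf0.
Qed.

(** The conclusion is Ext^{n+1}(M, N) = 0, read as Ext^1 of [M] and the [n]-th cosyzygy of [N]. Each
    step of the induction trades a syzygy of [M] for a cosyzygy of [N]. *)
Lemma pd_le_lifts n M N :
  pd_le n M -> lifts (ih_q (injhull (cosyzygy N n))) M.
Proof.
elim: n M => [|n IH] M /=.
  by move=> Mproj f; apply: Mproj; apply: se_surj (ih_exact _).
move=> [K [P [i [p [ip Pproj /IH KN]]]]].
apply: (lifts_of_extends_ses ip (ih_exact (injhull (cosyzygy N n.+1))) Pproj).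
by apply: extends_of_lifts KN; [apply: se_inj ip | apply: ih_inj].
Qed.

(** The dual reading: Ext^1 of the [n]-th syzygy of [M] and [N] vanishes. *)
Lemma id_le_extends n M N :
  id_le n N -> extends (pc_i (projcover (syzygy M n))) N.
Proof.
elim: n N => [|n IH] N /=.
  by move=> Ninj f; apply: Ninj; apply: se_inj (pc_exact _).
move=> [E [C [j [q [jq Einj /IH CM]]]]].
apply: (extends_of_lifts_ses (pc_exact (projcover (syzygy M n.+1))) jq Einj).
by apply: lifts_of_extends CM; [apply: se_surj jq | apply: pc_proj].
Qed.

Lemma injective_resolution_exists n N : (forall M, pd_le n M) ->
  exists E : right_resolution N, (forall k, is_injective (E k)) /\ length_le E n.
Proof.
move=> pd; apply: cosyzygy_resolution.
pose c := injhull (cosyzygy N n).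
(* The projective dimension bound is used for the next cosyzygy itself, whose identity then
   lifts. *)
have qC : lifts (ih_q c) (cosyzygy N n.+1) by apply: pd_le_lifts.
exact: lifts_id_injective (ih_exact c) (@ih_inj _ c) qC.
Qed.

(** The bound is applied only to the kernel of the cover of the [n]-th syzygy, a submodule of a
    projective module; that cover then splits. *)
Lemma projective_resolution_exists n M :
  (forall K P (i : {linear K -> P}), is_projective P -> injective i -> id_le n K) ->
  exists P : left_resolution M, (forall k, is_projective (P k)) /\ length_le P n.
Proof.
move=> idK; apply: syzygy_resolution; pose c := projcover (syzygy M n).
apply: (extends_id_projective (pc_exact c) (@pc_proj _ c)).
apply: id_le_extends; apply: (idK _ _ (pc_i c) (@pc_proj _ c)).
exact: se_inj (pc_exact c).
Qed.

End DimensionShifting.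

(** * Tensor products *)

Lemma freeg_additive_ind (K : choiceType) (T : {freeg K} -> Prop) :
  is_subgroup T -> (forall x, T << x >>) -> forall D, T D.
Proof.
move=> Tsub Tx D; rewrite -[D]freeg_sumE; elim/big_ind: _.
- by case: Tsub.
- exact: subgroupD.
- move=> x _; rewrite -[coeff x D]intz -freegU_mulz; exact: subgroupMz.
Qed.

Section TensorTheory.
Variables (R : pzRingType).
Implicit Types A B C H : lmodType R^c.
Implicit Types K L M N G : lmodType R.

Lemma tensor_ind H M (T : tensor H M -> Prop) :
  is_subgroup T -> (forall h m, T (tens h m)) -> forall t, T t.
Proof.
move=> [T0 TB] Tt t; rewrite -(reprK (t : Quotient.quot _)).
apply: (@freeg_additive_ind _ (fun D => T (tensor_pi D))) => [|[h m]]; last exact: Tt.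
by split=> [|x y Tx Ty]; rewrite ?raddf0 ?raddfB //; apply: TB.
Qed.

Lemma tensor_map_ext_ind H M (V : zmodType) (u v : {additive tensor H M -> V}) :
  (forall h m, u (tens h m) = v (tens h m)) -> u =1 v.
Proof.
move=> uv; apply: tensor_ind => //; split=> [|x y ux uy]; first by rewrite !raddf0.
by rewrite !raddfB ux uy.
Qed.

Lemma tensDl H M (h h' : H) (m : M) : tens (h + h') m = tens h m + tens h' m.
Proof.
rewrite /tens -raddfD /=; apply/tensor_piP.
by rewrite opprD addrA; apply: tensor_spanDl.
Qed.

Lemma tensDr H M (h : H) (m m' : M) : tens h (m + m') = tens h m + tens h m'.
Proof.
rewrite /tens -raddfD /=; apply/tensor_piP.
by rewrite opprD addrA; apply: tensor_spanDr.
Qed.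

Lemma tensZ H M (a : R) (h : H) (m : M) : tens ((a : R^c) *: h) m = tens h (a *: m).
Proof. by apply/tensor_piP; apply: tensor_spanZ. Qed.

Lemma tens0l H M (m : M) : tens (0 : H) m = 0.
Proof. by apply: (addIr (tens 0 m)); rewrite -tensDl !add0r. Qed.

Lemma tens0r H M (h : H) : tens h (0 : M) = 0.
Proof. by apply: (addIr (tens h 0)); rewrite -tensDr !add0r. Qed.

Lemma tensBl H M (h h' : H) (m : M) : tens (h - h') m = tens h m - tens h' m.
Proof. by apply/(addIr (tens h' m)); rewrite -tensDl !subrK. Qed.

Lemma tensBr H M (h : H) (m m' : M) : tens h (m - m') = tens h m - tens h m'.
Proof. by apply/(addIr (tens h m')); rewrite -tensDr !subrK. Qed.

Lemma tens_sumr H M (I : Type) (s : seq I) (h : H) (F : I -> M) :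
  tens h (\sum_(i <- s) F i) = \sum_(i <- s) tens h (F i).
Proof.
by elim: s => [|i s IH]; rewrite ?big_nil ?tens0r // !big_cons tensDr IH.
Qed.

(** The universal property: the free extension of [beta] kills the relations, so it can be evaluated
    on representatives. *)
Lemma tensor_lift H M (V : zmodType) (beta : H -> M -> V) :
  (forall h h' m, beta (h + h') m = beta h m + beta h' m) ->
  (forall h m m', beta h (m + m') = beta h m + beta h m') ->
  (forall (a : R) h m, beta ((a : R^c) *: h) m = beta h (a *: m)) ->
  exists phi : tensor H M -> V,
    zmod_morphism phi /\ forall h m, phi (tens h m) = beta h m.
Proof.
move=> bDl bDr bZ.
pose g : {freeg (H * M)} -> V := @fglift _ (zmodule V) _ (fun k => beta k.1 k.2).
have gB : zmod_morphism g by exact: (@lift_is_additive int _ (zmodule V)).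
have gU k : g << k >> = beta k.1 k.2 by rewrite /g (@liftU int (zmodule V)) scale1r.
have g_span x : tensor_span x -> g x = 0.
  elim=> [|{}x y _ gx _ gy|h h' m|h m m'|a h m]; rewrite ?(gB, gU) /=.
  - by have := gB 0 0; rewrite !subrr.
  - by rewrite gx gy subrr.
  - by rewrite bDl -addrA -opprD subrr.
  - by rewrite bDr -addrA -opprD subrr.
  - by rewrite bZ subrr.
have gpi x y : tensor_pi x = tensor_pi y -> g x = g y.
  by move=> /tensor_piP/g_span/eqP; rewrite gB subr_eq0 => /eqP.
pose r (t : tensor H M) : {freeg (H * M)} := repr (t : Quotient.quot (@tensor_rel R H M)).
have rK t : tensor_pi (r t) = t by rewrite /tensor_pi reprK.
exists (g \o r); split=> [x y|h m] /=.
  by rewrite -gB; apply: gpi; rewrite (raddfB (@tensor_pi R H M)) /= !rK.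
by rewrite -(gU (h, m)); apply: gpi; rewrite rK.
Qed.

Lemma tensor_map_comp H H1 H2 M M1 M2
    (f : {linear H -> H1}) (f' : {linear H1 -> H2}) (f'' : {linear H -> H2})
    (g : {linear M -> M1}) (g' : {linear M1 -> M2}) (g'' : {linear M -> M2}) :
  (forall h, f' (f h) = f'' h) -> (forall m, g' (g m) = g'' m) ->
  forall t, tensor_map f' g' (tensor_map f g t) = tensor_map f'' g'' t.
Proof.
move=> ff gg; apply: (tensor_map_ext_ind
  (u := tensor_map f' g' \o tensor_map f g) (v := tensor_map f'' g'')).
by move=> h m /=; rewrite !tensor_map_tens ff gg.
Qed.

Lemma tensor_map_swap H H' M M' (f : {linear H -> H'}) (g : {linear M -> M'}) t :
  tensor_map f (idfun : {linear M' -> M'}) (tensor_map (idfun : {linear H -> H}) g t) =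
  tensor_map (idfun : {linear H' -> H'}) g (tensor_map f (idfun : {linear M -> M}) t).
Proof. by rewrite !(tensor_map_comp (f'' := f) (g'' := g)). Qed.

Lemma tensor_map_surj H H' M M' (f : {linear H -> H'}) (g : {linear M -> M'}) :
  is_surjective f -> is_surjective g -> is_surjective (tensor_map f g).
Proof.
move=> fS gS; apply: tensor_ind.
  split=> [|_ _ [x <-] [y <-]]; first by exists 0; rewrite raddf0.
  by exists (x - y); rewrite raddfB.
move=> h m; have [h' <-] := fS h; have [m' <-] := gS m.
by exists (tens h' m'); rewrite tensor_map_tens.
Qed.

(* Right exactness in both arguments at once: the kernel of f (x) g is generated
   by the tensors b (x) m with f b = 0 or g m = 0. *)
Lemma tensor_map_ker B C M N (f : {linear B -> C}) (g : {linear M -> N})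
    (T : tensor B M -> Prop) : is_surjective f -> is_surjective g ->
  is_subgroup T -> (forall b m, f b = 0 \/ g m = 0 -> T (tens b m)) ->
  forall t, tensor_map f g t = 0 -> T t.
Proof.
move=> /choice[s sK] /choice[r rK] Tsub Tker.
have [T0 TB] := Tsub.
(* [s] and [r] are mere set-theoretic sections. Modulo [T], however, [sr] respects the tensor
   relations and is a left inverse of [freeg_map f g]. *)
pose sr : {freeg (C * N)} -> {freeg (B * M)} :=
  fglift (fun k => << (s k.1, r k.2) >>).
have srB : zmod_morphism sr by exact: lift_is_additive.
have srU c n : tensor_pi (sr << (c, n) >>) = tens (s c) (r n).
  by rewrite /sr liftU scale1r.
have sr_span x : tensor_span x -> T (tensor_pi (sr x)).
  elim=> [|{}x y _ Tx _ Ty|c c' n|c n n'|a c n];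
    rewrite ?srB ?raddfB ?srB ?raddfB /= ?srU.
  - by have := srB 0 0; rewrite !subrr => ->; rewrite raddf0.
  - exact: TB.
  - rewrite -!tensBl; apply: Tker; left.
    by rewrite !raddfB /= !sK addrAC addrK subrr.
  - rewrite -!tensBr; apply: Tker; right.
    by rewrite !raddfB /= !rK addrAC addrK subrr.
  - rewrite -(subrK (tens ((a : R^c) *: s c) (r n)) (tens (s _) _)) -tensBl -addrA.
    rewrite tensZ -tensBr; apply: (subgroupD Tsub); apply: Tker; [left|right].
      by rewrite raddfB /= linearZ /= !sK subrr.
    by rewrite raddfB /= linearZ /= !rK subrr.
have sr_map x : T (tensor_pi (sr (freeg_map f g x)) - tensor_pi x).
  apply: (@freeg_additive_ind _
    (fun x => T (tensor_pi (sr (freeg_map f g x)) - tensor_pi x))).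
    split=> [|y z Ty Tz].
      have fg0 : freeg_map f g 0 = 0 by have := freeg_mapB f g 0 0; rewrite !subrr.
      by rewrite fg0; have := srB 0 0; rewrite !subrr => ->; rewrite subrr.
    rewrite freeg_mapB srB !raddfB /=; have := TB _ _ Ty Tz.
    by rewrite opprD addrACA -opprD.
  move=> [b m]; rewrite freeg_mapU srU.
  rewrite -(subrK (tens (s (f b)) m) (tens _ (r _))) -tensBr -addrA -tensBl.
  apply: (subgroupD Tsub); apply: Tker; [right|left].
    by rewrite raddfB /= rK subrr.
  by rewrite raddfB /= sK subrr.
move=> t; rewrite -(reprK (t : Quotient.quot _)) -/(tensor_pi _); move: (repr _) => x.
rewrite tensor_mapE -(raddf0 (@tensor_pi R C N)) => /tensor_piP.
rewrite subr0 => /sr_span Tx.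
by have := TB _ _ Tx (sr_map x); rewrite opprB addrC subrK.
Qed.

Lemma tensor_right_exact_l A B C K (i : {linear A -> B}) (p : {linear B -> C}) :
  is_surjective p -> exact_at i p ->
  exact_at (tensor_map i (idfun : {linear K -> K}))
           (tensor_map p (idfun : {linear K -> K})).
Proof.
move=> pS ip t; split=> [|[a <-]].
  apply: (tensor_map_ker
    (T := fun t => exists x, tensor_map i (idfun : {linear K -> K}) x = t)) => //.
  + by move=> x; exists x.
  + split=> [|_ _ [x <-] [y <-]]; first by exists 0; rewrite raddf0.
    by exists (x - y); rewrite raddfB.
  + move=> b m [/ip[a <-]|/= ->]; last by exists 0; rewrite raddf0 tens0r.
  by exists (tens a m); rewrite tensor_map_tens.
elim/tensor_ind: a => [|a m]; last first.
  by rewrite !tensor_map_tens (_ : p (i a) = 0) ?tens0l //; apply/ip; exists a.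
by split=> [|x y px py]; [rewrite !raddf0 | rewrite !raddfB /= px py subrr].
Qed.

Lemma tensor_right_exact_r H L G K (i : {linear L -> G}) (p : {linear G -> K}) :
  is_surjective p -> exact_at i p ->
  exact_at (tensor_map (idfun : {linear H -> H}) i)
           (tensor_map (idfun : {linear H -> H}) p).
Proof.
move=> pS ip t; split=> [|[a <-]].
  apply: (tensor_map_ker
    (T := fun t => exists x, tensor_map (idfun : {linear H -> H}) i x = t)) => //.
  + by move=> x; exists x.
  + split=> [|_ _ [x <-] [y <-]]; first by exists 0; rewrite raddf0.
    by exists (x - y); rewrite raddfB.
  + move=> b m [/= ->|/ip[a <-]]; first by exists 0; rewrite raddf0 tens0l.
  by exists (tens b a); rewrite tensor_map_tens.
elim/tensor_ind: a => [|h a]; last first.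
  by rewrite !tensor_map_tens (_ : p (i a) = 0) ?tens0r //; apply/ip; exists a.
by split=> [|x y px py]; [rewrite !raddf0 | rewrite !raddfB /= px py subrr].
Qed.

End TensorTheory.

(** * Dimensions and flatness *)

Lemma least_lengthP (L : set nat) : (exists n, L n) ->
  exists2 n, L n & least_length L = n%:R%:E.
Proof.
move=> [n0 Ln0]; have exL : exists n, `[< L n >] by exists n0; apply/asboolP.
have [n /asboolP Ln nmin] := ex_minnP exL; exists n => //.
apply/eqP; rewrite eq_le; apply/andP; split; first by apply: ereal_inf_lbound; exists n.
apply: le_ereal_inf_tmp => _ [m Lm <-]; rewrite lee_fin ler_nat.
by apply: nmin; apply/asboolP.
Qed.

(** Here [n] plays the integer part of [s]. An empty [L] has infimum [+oo], which would force [s] to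
    be [+oo] and contradict the bound at [n.+1]. *)
Lemma least_length_le (L : set nat) (s : exreal) (n : nat) :
  (forall m : nat, m%:R%:E <= s -> (m <= n)%N)%E -> (least_length L <= s)%E ->
  exists2 m, L m & (m <= n)%N.
Proof.
move=> sn; have [exL|noL] := pselect (exists m, L m).
  by have [m Lm ->] := least_lengthP exL => /sn; exists m.
rewrite /least_length (_ : [set _ | _ in L]%classic = set0); last first.
  by rewrite -subset0 => y [m Lm _]; case: noL; exists m.
rewrite ereal_inf0 leye_eq => /eqP soo.
by have := sn n.+1; rewrite soo leey ltnn => /(_ isT).
Qed.

Lemma least_length_ge0 (L : set nat) : (0 <= least_length L)%E.
Proof. by apply: le_ereal_inf_tmp => _ [m _ <-]; rewrite lee_fin. Qed.

Lemma ereal_nat_floor (s : exreal) : (0 <= s)%E -> s = +oo%E \/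
  exists n : nat, (n%:R%:E <= s)%E /\ forall m : nat, (m%:R%:E <= s)%E -> (m <= n)%N.
Proof.
case: s => [r| |] //; last by left.
rewrite lee_fin => r0; right; exists (Num.truncn r); split.
  by rewrite lee_fin truncn_le.
by move=> m; rewrite lee_fin truncn_ge_nat.
Qed.

(** * Flatness of free modules *)

Section FreeModulesAreFlat.
Variables (R : pzRingType) (X : eqType) (G : lmodType R) (e : X -> G).
Hypothesis eB : is_basis e.

(** The expansion is claimed over every duplicate-free list containing a support, so that elements
    with different supports can be added over a common list. *)
Lemma basis_coord : exists phi : X -> {linear G -> R^o}, forall g, exists s : seq X,
  forall s', uniq s' -> {subset s <= s'} -> g = \sum_(x <- s') (phi x g : R) *: e x.
Proof.
have [univ gen] := eB.
have /choice[phi phiE] x := univ R^o (fun y => (x == y)%:R).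
exists phi => g; have [l ->] := gen g.
elim: l => [|[a y] l [s sE]].
  by exists [::] => s' _ _; rewrite big_nil big1 // => x _; rewrite raddf0 scale0r.
exists (y :: s) => s' s'U ys'; rewrite big_cons /=.
under [RHS]eq_bigr do rewrite raddfD /= linearZ /= phiE scalerDl.
rewrite big_split /= -sE // => [|x xs]; last by apply: ys'; rewrite inE xs orbT.
congr (_ + _); rewrite (bigD1_seq y) ?ys' ?mem_head //= eqxx.
rewrite [a *: (1 : R^o)]mulr1 big1 ?addr0 // => x xy.
by rewrite (negPf xy) [a *: (0 : R^o)]mulr0 scale0r.
Qed.

(** Coordinates identify a tensor product with [G] with a direct sum of copies of the other factor;
    they commute with [i], so injectivity is checked coordinatewise. *)
Lemma basis_flat (A B : lmodType R^c) (i : {linear A -> B}) :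
  injective i -> injective (tensor_map i (idfun : {linear G -> G})).
Proof.
move=> iI; have [phi phiP] := basis_coord.
have coord (H : lmodType R^c) : exists kappa : X -> tensor H G -> H,
    (forall x, zmod_morphism (kappa x)) /\
    (forall x h g, kappa x (tens h g) = (phi x g : R^c) *: h).
  have /choice[kappa kP] x : exists k : tensor H G -> H,
      zmod_morphism k /\ forall h g, k (tens h g) = (phi x g : R^c) *: h.
    apply: tensor_lift => [h h' m|h m m'|a h m].
    - exact: scalerDr.
    - by rewrite raddfD /= scalerDl.
    - by rewrite scalerA linearZ.
  by exists kappa; split=> [x|x h g]; have [] := kP x.
have [kA [kAB kAE]] := coord A; have [kB [kBB kBE]] := coord B.
have expand t : exists s : seq X, forall s', uniq s' -> {subset s <= s'} ->
    t = \sum_(x <- s') tens (kA x t) (e x).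
  have k0 x : kA x 0 = 0 by have := kAB x 0 0; rewrite !subrr.
  elim/tensor_ind: t.
    split=> [|t u [s sE] [s2 s2E]].
      by exists [::] => s' _ _; rewrite big1 // => x _; rewrite k0 tens0l.
    exists (s ++ s2) => s' s'U ss'; under eq_bigr do rewrite kAB tensBl.
    rewrite sumrB -sE // => [|x xs]; last by apply: ss'; rewrite mem_cat xs.
    by rewrite -s2E // => x xs; apply: ss'; rewrite mem_cat xs orbT.
  move=> a g; have [s sE] := phiP g; exists s => s' s'U ss'.
  rewrite {1}(sE s') // tens_sumr; apply: eq_bigr => x _.
  by rewrite kAE tensZ.
apply: raddf_inj => t it0; have [s sE] := expand t.
rewrite (sE (undup s)) ?undup_uniq // => [|x]; last by rewrite mem_undup.
apply: big1 => x _; rewrite (_ : kA x t = 0) ?tens0l //.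
apply: iI; rewrite raddf0.
have <- : kB x (tensor_map i (idfun : {linear G -> G}) t) = i (kA x t).
  elim/tensor_ind: (t) => [|a g]; last by rewrite tensor_map_tens kAE kBE linearZ.
  split=> [|u v uE vE]; last by rewrite raddfB /= kBB uE vE kAB raddfB.
  have := kAB x 0 0; rewrite !subrr raddf0 => ->; rewrite raddf0.
  by have := kBB x 0 0; rewrite !subrr.
by rewrite it0; have := kBB x 0 0; rewrite !subrr.
Qed.

End FreeModulesAreFlat.

(** * Vanishing of Tor for modules of flat dimension at most one *)

Section F1Flatness.
Variable R : pzRingType.

(** This is Tor_1(C, K) = 0, by a chase with 0 -> L -> G -> K -> 0 and [G] free. A lift of [t] to A
    (x) G has image in B (x) L; flatness of [C] brings that back to A (x) L, and flatness of [G]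
    shows that the lift itself comes from there. *)
Lemma flat_quotient_pure (A B C : lmodType R^c) (i : {linear A -> B})
    (p : {linear B -> C}) (K : lmodType R) :
  short_exact i p -> is_flat C -> injective (tensor_map i (idfun : {linear K -> K})).
Proof.
move=> [iI ip pS] Cflat; have [G [e [q [eB qS]]]] := free_cover K.
have [L [l [lI lq]]] := kernel_exists q.
apply: raddf_inj => t it0.
have idS (V : Type) : is_surjective (idfun : V -> V) by move=> x; exists x.
have [t' t'E] := tensor_map_surj (idS A) qS t.
have [s sE] : exists s, tensor_map (idfun : {linear B -> B}) l s =
    tensor_map i (idfun : {linear G -> G}) t'.
  apply/(tensor_right_exact_r qS lq); rewrite -tensor_map_swap.
  by have := t'E; rewrite /= => ->.
have [r rE] : exists r, tensor_map i (idfun : {linear L -> L}) r = s.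
  apply/(tensor_right_exact_l pS ip); apply: (Cflat _ _ l lI).
  rewrite raddf0 -tensor_map_swap sE.
  by apply/(tensor_right_exact_l pS ip); exists t'.
have <- : tensor_map (idfun : {linear A -> A}) q
    (tensor_map (idfun : {linear A -> A}) l r) = t.
  rewrite -t'E; congr (tensor_map _ _ _); apply: (basis_flat eB iI).
  by rewrite tensor_map_swap rE sE.
by apply/(tensor_right_exact_r qS lq); exists r.
Qed.

(* Tor_1(H, K) is a quotient of Tor_2(H, G / K) = 0. *)
Lemma free_submodule_F1_flat (X : eqType) (G K : lmodType R) (e : X -> G)
    (k : {linear K -> G}) : is_basis e -> injective k -> F1_flat K.
Proof.
move=> eB kI H HF1 P Pproj.
have [|n [F [Fflat Flen]] n_le1] := least_length_le (n := 1) _ HF1.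
  by move=> m; rewrite lee_fin lern1.
have [Om [w [a [wP aS aE wa]]]] := resolution_syzygy P.
have [wI wE pS] := wP.
(* The differential factors as [w \o a] with [a] surjective onto the syzygy, so exactness in degree
   1 reduces to injectivity of [w] tensored with [K]. *)
suff wKI : injective (tensor_map w (idfun : {linear K -> K})).
  have d0E t : tensor_map (lres_d P 0) (idfun : {linear K -> K}) t =
      tensor_map w (idfun : {linear K -> K}) (tensor_map a (idfun : {linear K -> K}) t).
    by rewrite (tensor_map_comp (f'' := lres_d P 0) (g'' := idfun)).
  move=> t; rewrite d0E -(tensor_right_exact_l (K := K) aS aE t).
  split=> [|->]; last exact: raddf0.
  by rewrite -(raddf0 (tensor_map w (idfun : {linear K -> K}))) => /wKI.
pose dF := lres_d F 0; pose aF := lres_aug F.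
have dFI : injective dF.
  apply: raddf_inj => y /(@lres_exactS _ _ F 0)[z <-].
  by rewrite (Flen 2%N n_le1 z) raddf0.
have [f fE] := Pproj 0%N _ _ aF (lres_aug P) (lres_aug_surj F).
have [|g gE] := linear_factor_inj (u := f \o w) dFI.
  move=> x; apply/(@lres_exact0 _ _ F); rewrite /= fE.
  by apply/wE; exists x.
(* The comparison maps [f] and [g] from the projective to the flat resolution give the mapping cone
   sequence 0 -> Om -> P 0 + F 1 -> F 0 -> 0, which stays injective on the left after tensoring
   since [F 0] is flat. *)
pose B : lmodType R^c := (P 0%N * F 1%N)%type.
have [|i iE] := @linear_bundle _ Om B (fun x => (w x, g x)).
  by move=> c x y; rewrite !linearP.
have [|p pE] := @linear_bundle _ B (F 0%N) (fun z => f z.1 - dF z.2).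
  by move=> c x y; rewrite /= !linearP /= addrACA -scalerDr.
have ip : short_exact i p.
  split.
  - by move=> x y; rewrite !iE => -[/wI].
  - move=> [x y]; rewrite pE /=; split=> [fd|[z]].
      have fd' : f x = dF y by apply/eqP; rewrite -subr_eq0 fd.
      have [z zE] : exists z, w z = x.
        by apply/wE; rewrite -fE fd'; apply/(@lres_exact0 _ _ F); exists y.
      by exists z; rewrite iE zE; congr (_, _); apply: dFI; rewrite gE /= zE.
    by rewrite iE => -[<- <-]; rewrite gE subrr.
  - move=> z; have [x xE] := pS (aF z).
    have [y yE] : exists y, dF y = f x - z.
      by apply/(@lres_exact0 _ _ F); rewrite raddfB /= fE xE subrr.
    by exists (x, y); rewrite pE /= yE opprB addrC subrK.
apply: raddf_inj => t wt0; apply: (flat_quotient_pure (K := K) ip (Fflat 0%N)).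
rewrite raddf0.
(* Flatness of [F 1] embeds F 1 (x) K into F 1 (x) G, and freeness of [G] embeds the latter into F 0
   (x) G. There the image of [t] vanishes, because [dF \o g = f \o w]. *)
have gt0 : tensor_map g (idfun : {linear K -> K}) t = 0.
  apply: (Fflat 1%N _ _ k kI); rewrite raddf0.
  apply: (basis_flat eB dFI); rewrite raddf0.
  rewrite tensor_map_swap.
  have -> : tensor_map dF (idfun : {linear K -> K}) (tensor_map g idfun t) =
      tensor_map f idfun (tensor_map w idfun t).
    by rewrite !(tensor_map_comp (f'' := f \o w) (g'' := idfun)).
  by rewrite wt0 !raddf0.
have [|in1 in1E] := @linear_bundle _ (P 0%N) B (fun x => (x, 0)).
  by move=> c x y; rewrite -[RHS]/(_, c *: 0 + 0) scaler0 addr0.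
have [|in2 in2E] := @linear_bundle _ (F 1%N) B (fun y => (0, y)).
  by move=> c x y; rewrite -[RHS]/(c *: 0 + 0, _) scaler0 addr0.
(* Both components of [i] kill [t] after tensoring, hence so does [i]. *)
have -> : tensor_map i (idfun : {linear K -> K}) t =
    tensor_map in1 idfun (tensor_map w idfun t) +
    tensor_map in2 idfun (tensor_map g idfun t).
  elim/tensor_ind: (t) => [|h m].
    split=> [|u v uE vE]; first by rewrite !raddf0 addr0.
    by rewrite !raddfB /= uE vE opprD addrACA.
  rewrite !tensor_map_tens -tensDl iE in1E in2E; congr tens.
  by rewrite -[RHS]/(w h + 0, 0 + g h) addr0 add0r.
by rewrite wt0 gt0 !raddf0 addr0.
Qed.

End F1Flatness.

(** * Comparison of the three suprema *)

Lemma dim_sup_sub (S : pzRingType) (C C' : lmodType S -> Prop) dim :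
  (forall M, C M -> C' M) -> (dim_sup C dim <= dim_sup C' dim)%E.
Proof.
by move=> CC'; apply: ereal_sup_le => _ [M CM ->]; exists M => //; apply: CC'.
Qed.

Lemma dim_sup_ubound (S : pzRingType) (C : lmodType S -> Prop) dim M :
  C M -> (dim M <= dim_sup C dim)%E.
Proof. by move=> CM; apply: ereal_sup_ubound; exists M. Qed.

Lemma length_le_trans (S : pzRingType) (P : nat -> lmodType S) (m n : nat) :
  (m <= n)%N -> length_le P m -> length_le P n.
Proof. by move=> mn Pm k nk; apply: Pm; apply: leq_ltn_trans nk. Qed.

Lemma inj_dim_le_gl_dim (R : pzRingType) (N : lmodType R) :
  (inj_dim N <= l_gl_dim R)%E.
Proof.
have pdM M : (@proj_dim R M <= l_gl_dim R)%E by exact: dim_sup_ubound.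
(* [N] itself shows that the supremum is nonnegative. If finite, it is replaced by its integer part
   [n], which still bounds all projective dimensions. *)
have [->|[n [ns sn]]] := ereal_nat_floor (le_trans (least_length_ge0 _) (pdM N)).
  exact: leey.
apply: le_trans ns; apply: ereal_inf_lbound; exists n => //.
apply: injective_resolution_exists => M.
have [m [P [Pproj Plen]] mn] := least_length_le sn (pdM M).
exact: resolution_pd_le Pproj (length_le_trans mn Plen).
Qed.

Lemma proj_dim_le_F1_flat (R : pzRingType) (M : lmodType R) :
  (proj_dim M <= dim_sup (@F1_flat R) (@inj_dim R))%E.
Proof.
set s := dim_sup _ _.
have idK (K P : lmodType R) (i : {linear K -> P}) :
    is_projective P -> injective i -> (inj_dim K <= s)%E.
  move=> Pproj iI; apply: dim_sup_ubound; have [F [e [p [eB pS]]]] := free_cover P.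
  (* A projective module is a summand of a free one, so [K] is also a submodule of a free module. *)
  have [j jE] := Pproj _ _ p idfun pS.
  apply: (free_submodule_F1_flat (k := j \o i) eB) => x y /= /(congr1 p).
  by rewrite !jE => /iI.
have [F [e [p [eB pS]]]] := free_cover M.
(* A free module is F_1-flat, so the supremum is over a nonempty class and is nonnegative. *)
have Fid := idK F F idfun (basis_projective eB) (fun _ _ => id).
have [->|[n [ns sn]]] := ereal_nat_floor (le_trans (least_length_ge0 _) Fid).
  exact: leey.
apply: le_trans ns; apply: ereal_inf_lbound; exists n => //.
apply: projective_resolution_exists => K P i Pproj iI.
have [m [E [Einj Elen]] mn] := least_length_le sn (idK _ _ _ Pproj iI).
exact: resolution_id_le Einj (length_le_trans mn Elen).
Qed.

Theorem corollary4p3 (R : pzRingType) :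
  l_gl_dim R = dim_sup (@F1_flat R) (@inj_dim R) /\
  dim_sup (@F1_flat R) (@inj_dim R) = dim_sup (@F1fp_flat R) (@inj_dim R).
Proof.
have gl_F1 : (l_gl_dim R <= dim_sup (@F1_flat R) (@inj_dim R))%E.
  by apply: ge_ereal_sup => _ [M _ ->]; apply: proj_dim_le_F1_flat.
have F1_F1fp : (dim_sup (@F1_flat R) (@inj_dim R) <=
                dim_sup (@F1fp_flat R) (@inj_dim R))%E.
  by apply: dim_sup_sub => M MF H [/MF].
have F1fp_gl : (dim_sup (@F1fp_flat R) (@inj_dim R) <= l_gl_dim R)%E.
  by apply: ge_ereal_sup => _ [M _ ->]; apply: inj_dim_le_gl_dim.
split; apply: le_anti; rewrite ?gl_F1 ?F1_F1fp /=.
  exact: le_trans F1fp_gl.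
exact: le_trans gl_F1.
Qed.
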